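(* Let $q$ be a prime power, and let $m, r$ be nonnegative integers such that $m\ge 1$ and $0\le r\le m(q-1)$. Then the (generalized) Reed-Muller code $\mathcal{RM}_q(r,m)$ is an MDS code if and only if $m=1$ or $r=0$ or $r\ge m(q-1)-1$.
   Context: Let $\mathbb{F}_q$ be the finite field with $q$ elements. For integers $m\ge 1$ and $0\le r\le m(q-1)$, let $$V_q(r,m)=\{f\in\mathbb{F}_q[X_1,\dots,X_m] : \deg(f)\le r \text{ and } \deg_{X_i}(f)<q \text{ for } i=1,\dots,m\}.$$ Fix an ordering $\mathsf{P}_1,\dots,\mathsf{P}_{q^m}$ of the elements of $\mathbb{F}_q^m$. The Reed-Muller code $\mathcal{RM}_q(r,m)$ of order $r$ is the image of the linear map $V_q(r,m)\to\mathbb{F}_q^{q^m}$, $f\mapsto (f(\mathsf{P}_1),\dots,f(\mathsf{P}_{q^m}))$; it is a linear code of length $q^m$. A linear code over $\mathbb{F}_q$ of length $n$, dimension $k\ge 1$ and minimum (Hamming) distance $d$ is an MDS code if $d=n-k+1$. *)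

(* Defs.v *)
From HB Require Import structures.
From mathcomp Require Export all_boot all_order all_algebra all_field.
From mathcomp.multinomials Require Export mpoly.

Set Implicit Arguments.
Unset Strict Implicit.
Unset Printing Implicit Defensive.

Import GRing.Theory.
Local Open Scope ring_scope.

Section LinearCodes.
Context (F : finFieldType) (n : nat).
Implicit Type C : {vspace 'rV[F]_n}.

Definition hamming_dist (x y : 'rV[F]_n) : nat := #|[set i | x 0 i != y 0 i]|.

(* The default value n is harmless: it bounds every Hamming distance, so it is
   only significant for the zero code, which [MDS] excludes. *)
Definition min_dist C : nat :=
  \big[minn/n]_(x in C) \big[minn/n]_(y in C | x != y) hamming_dist x y.

Definition MDS C : Prop :=
  (1 <= \dim C)%N /\ min_dist C = (n - \dim C + 1)%N.

End LinearCodes.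

Definition degX (R : nzRingType) (m : nat) (i : 'I_m) (f : {mpoly R[m]}) : nat :=
  \max_(u <- msupp f) u i.

Section ReedMuller.
Context (F : finFieldType) (r m : nat).
Local Notation q := #|F|.

(* [msize f] is deg f + 1, and 0 for f = 0. *)
Definition rm_pred : {pred {mpoly F[m]}} :=
  fun f => (msize f <= r.+1)%N && [forall i : 'I_m, (degX i f < q)%N].

Definition rm_mon (u : 'X_{1..m}) : bool :=
  (mdeg u <= r)%N && [forall i : 'I_m, (u i < q)%N].

Lemma rm_predE f : (f \in rm_pred) = all rm_mon (msupp f).
Proof.
have q_gt0 : (0 < q)%N by apply/card_gt0P; exists 0.
apply/andP/allP => [[sz /forallP dX] u uf|H].
  apply/andP; split; first by rewrite -ltnS (leq_trans (msize_mdeg_lt uf) sz).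
  apply/forallP => i; apply: leq_ltn_trans (dX i).
  by rewrite /degX (bigD1_seq u) ?msupp_uniq //= leq_maxl.
split.
  rewrite msizeE big_seq; elim/big_ind: _ => // [x y|u uf].
    by rewrite geq_max => -> ->.
  by case/andP: (H u uf).
apply/forallP => i; rewrite /degX big_seq; elim/big_ind: _ => // [x y|u uf].
  by rewrite gtn_max => -> ->.
by case/andP: (H u uf) => _ /forallP.
Qed.

Fact rm_pred_submod : submod_closed rm_pred.
Proof.
split=> [|c f g]; rewrite !rm_predE ?msupp0 // => /allP Hf /allP Hg.
apply/allP => u /msuppD_le; rewrite mem_cat => /orP[/msuppZ_le|]; last exact: Hg.
exact: Hf.
Qed.
HB.instance Definition _ :=
  GRing.isSubmodClosed.Build F {mpoly F[m]} rm_pred rm_pred_submod.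

Record rm_poly := RMPoly { rm_val :> {mpoly F[m]}; _ : rm_val \in rm_pred }.

HB.instance Definition _ := [isSub for rm_val].
HB.instance Definition _ := [Choice of rm_poly by <:].
HB.instance Definition _ := [SubChoice_isSubLmodule of rm_poly by <:].

Let mons := [set u : 'X_{1..m < r.+1} | rm_mon u].

Fact rm_poly_vecaxiom : Vector.axiom #|mons| rm_poly.
Proof.
pose M (i : 'I_#|mons|) : 'X_{1..m} := enum_val i : 'X_{1..m < r.+1}.
have injM : injective M by move=> i j /val_inj /enum_val_inj.
exists (fun f : rm_poly => \row_i f@_(M i)) => [c f g|].
  by apply/rowP => i; rewrite !mxE /= mcoeffD mcoeffZ.
pose g (v : 'rV[F]_#|mons|) : {mpoly F[m]} := \sum_i v 0 i *: 'X_[M i].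
have gP v : g v \in rm_pred.
  apply: rpred_sum => i _; apply: rpredZ; rewrite rm_predE msuppX /= andbT.
  by have := enum_valP i; rewrite inE.
have gE v i : (g v)@_(M i) = v 0 i.
  rewrite raddf_sum (bigD1 i) //= mcoeffZ mcoeffX eqxx mulr1 big1 ?addr0 //.
  by move=> j ji; rewrite mcoeffZ mcoeffX (inj_eq injM) (negbTE ji) mulr0.
exists (fun v => RMPoly (gP v)) => [f|v]; last first.
  by apply/rowP => i; rewrite mxE gE.
apply/val_inj/mpolyP => u /=.
have [/andP[du qu]|nu] := boolP (rm_mon u).
  have lt_u : (mdeg u < r.+1)%N by rewrite ltnS.
  have uA : BMultinom lt_u \in mons by rewrite inE /rm_mon /= du qu.
  have -> : u = M (enum_rank_in uA (BMultinom lt_u)) by rewrite /M enum_rankK_in.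
  by rewrite gE mxE.
have out h : h \in rm_pred -> h@_u = 0.
  rewrite rm_predE => /allP H; apply/eqP; rewrite mcoeff_eq0.
  by apply: contra nu; apply: H.
by rewrite !out //; exact: valP.
Qed.
HB.instance Definition _ :=
  Lmodule_hasFinDim.Build F rm_poly rm_poly_vecaxiom.

Context (P : 'I_(q ^ m) -> 'rV[F]_m).

Definition rm_eval (f : rm_poly) : 'rV[F]_(q ^ m) :=
  \row_j (rm_val f).@[P j 0].

Fact rm_eval_is_linear : linear rm_eval.
Proof. by move=> c f g; apply/rowP => j; rewrite !mxE /= mevalD mevalZ. Qed.
HB.instance Definition _ :=
  GRing.isLinear.Build F rm_poly 'rV[F]_(q ^ m) _ rm_eval rm_eval_is_linear.

Definition RM : {vspace 'rV[F]_(q ^ m)} := limg (linfun rm_eval).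

Lemma RM_P c :
  reflect (exists2 f : {mpoly F[m]}, f \in rm_pred & c = \row_j f.@[P j 0])
          (c \in RM).
Proof.
apply: (iffP memv_imgP) => [[f _ ->]|[f fV ->]].
  by exists (val f); [exact: valP | rewrite lfunE].
by exists (RMPoly fV); rewrite ?memvf // lfunE.
Qed.

End ReedMuller.

(* Main.v *)
Require Import Defs.
From mathcomp Require Import zify.

(** Write q = #|F|, n = q^m, N = m(q-1), and call the degree of an exponent
    vector the sum of its entries.  Numbering the elements of F by 0, ..., q-1
    identifies the points of F^m with the exponent vectors of reduced monomials,
    so that points and monomials can be counted by the same sets; the points x
    with deg x <= r form the set [low_points].

    To a point x belongs the product over i of the linear forms X_i - a, for
    all a numbered below x_i ([box_poly]).  It is a reduced polynomial of degree
    deg x, and it is nonzero exactly at the points y >= x (coordinatewise).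
    These polynomials are triangular with respect to that order, hence
    independent, so k = dim RM = #|low_points| ([dim_RM]) and n - k is the number of
    points of degree > r.

    If deg x = r, every point y >= x other than x has degree > r, so the word of
    [box_poly x] has weight at most n - k + 1; this recovers the Singleton bound
    ([min_dist_RM_le]).  Equality fails as soon as some point z of degree > r is
    not >= x.  When m >= 2 and 0 < r < N - 1, such a pair exists: let x_0 be as
    large as possible, and let z be full except that z_0 = x_0 - 1
    ([min_dist_RM_lt_singleton]).  So the code is not MDS.

    Conversely, the values of a polynomial of degree < N on F^m sum to 0,
    because power sums of exponent < q - 1 over F vanish ([sum_meval_eq0]).
    Multiplying a polynomial by one linear form for each point but one of its
    support leaves a function supported at a single point, whose sum is not 0;
    so a nonzero word has weight at least N - r + 1 ([weight_gt_of_degree]).  When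
    m = 1 or r >= N - 1, distinct points of degree > r have distinct degrees,
    so there are at most N - r of them and the weight is at least n - k + 1.
    For r = 0 the code is the repetition code. *)

Set Implicit Arguments.
Unset Strict Implicit.
Unset Printing Implicit Defensive.

Import GRing.Theory.
Local Open Scope ring_scope.

(** * Minimum distance as minimum weight *)

Section MinDist.
Context (F : finFieldType) (n : nat).
Implicit Type (C : {vspace 'rV[F]_n}) (c : 'rV[F]_n).

Definition weight c : nat := #|[set i | c 0 i != 0]|.

Lemma hamming_dist_weight c c' : hamming_dist c c' = weight (c - c').
Proof. by apply: eq_card => i; rewrite !inE !mxE subr_eq0. Qed.

Lemma min_dist_le_weight C c : c \in C -> c != 0 -> (min_dist C <= weight c)%N.
Proof.
(* [minn] has no neutral element on nat, so the lemmas on commutative monoid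
   laws do not apply and the bound is proved on the enumeration itself. *)
have bigmin_le (P : pred 'rV[F]_n) g x :
    P x -> (\big[minn/n]_(y | P y) g y <= g x)%N.
  move=> Px; have: x \in index_enum 'rV[F]_n by rewrite mem_index_enum.
  elim: index_enum => // y s IH; rewrite inE big_cons => /predU1P[<-|/IH le_x].
    by rewrite Px geq_minl.
  by case: ifP => // _; rewrite geq_min le_x orbT.
move=> cC c0; rewrite -[c]subr0 -hamming_dist_weight.
apply: leq_trans (bigmin_le _ _ _ cC) _.
by apply: bigmin_le; rewrite mem0v.
Qed.

Lemma le_min_dist C w : (w <= n)%N ->
  {in C, forall c, c != 0 -> (w <= weight c)%N} -> (w <= min_dist C)%N.
Proof.
move=> wn Cw; apply: (big_ind (fun d => (w <= d)%N)) => // [d d' ? ?|x xC].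
  by rewrite leq_min; apply/andP.
apply: (big_ind (fun d => (w <= d)%N)) => // [d d' ? ?|y /andP[yC xy]].
  by rewrite leq_min; apply/andP.
by rewrite hamming_dist_weight Cw ?memvB // subr_eq0.
Qed.

End MinDist.

(** * Exponent vectors and degrees *)

(** Raising one entry at a time changes the degree by 1, so every intermediate
    degree is reached. *)
Lemma mdeg_between m (a b : 'X_{1..m}) d :
    (a <= b)%MM -> (mdeg a <= d <= mdeg b)%N ->
  exists2 u : 'X_{1..m}, (a <= u)%MM && (u <= b)%MM & mdeg u = d.
Proof.
move Dk: (d - mdeg a)%N => k.
elim: k a Dk => [|k IH] a Dk ab /andP[ad db].
  by exists a; [rewrite lepm_refl | lia].
have [i lt_i] : exists i, (a i < b i)%N.
  apply/existsP; apply: contraT; rewrite negb_exists => /forallP Hi.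
  suff : (mdeg b <= mdeg a)%N by lia.
  by rewrite !mdegE leq_sum // => i _; rewrite leqNgt.
have le_a : (a <= a + U_(i))%MM by apply: lem_addr.
have [|||u /andP[au ub] du] := IH (a + U_(i))%MM.
- by rewrite mdegD mdeg1; lia.
- apply/mnm_lepP => j; rewrite mnmDE mnm1E; case: eqP => [<-|_].
    by rewrite addn1.
  by rewrite addn0; apply: (mnm_lepP ab).
- by rewrite mdegD mdeg1; lia.
by exists u; rewrite // ub (lepm_trans le_a au).
Qed.

Lemma lem_mdeg_eq m (u v : 'X_{1..m}) :
  (u <= v)%MM -> (mdeg v <= mdeg u)%N -> u = v.
Proof.
move=> le_uv; rewrite -{1}(submK le_uv) mdegD -{2}[mdeg u]add0n leq_add2r leqn0.
by rewrite mdeg_eq0 => /eqP vu0; rewrite -(submK le_uv) vu0 add0m.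
Qed.

Section Degrees.
Context (R : idomainType) (m : nat).
Implicit Types (f g : {mpoly R[m]}) (e : 'X_{1..m}).

(** A bound on all exponents at once controls both the total degree and the
    degree in each variable, and it is additive under products. *)
Definition msupp_le e f := all (fun u => (u <= e)%MM) (msupp f).

Lemma msupp_leM e e' f g :
  msupp_le e f -> msupp_le e' g -> msupp_le (e + e')%MM (f * g).
Proof.
move=> /allP fe /allP ge'; apply/allP => u /msuppM_le /allpairsP[[u1 u2] /=].
case=> /fe /mnm_lepP le1 /ge' /mnm_lepP le2 ->; apply/mnm_lepP => i.
by rewrite !mnmDE leq_add.
Qed.

Lemma msupp_le_prod (I : Type) (s : seq I) (e : I -> 'X_{1..m})
    (f : I -> {mpoly R[m]}) :
  (forall i, msupp_le (e i) (f i)) ->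
  msupp_le (\sum_(i <- s) e i)%MM (\prod_(i <- s) f i).
Proof.
move=> fe; apply: (big_rec2 (fun e f => msupp_le e f)) => [|i x y _ yx].
  by rewrite /msupp_le msupp1 /= andbT; apply/mnm_lepP => i; rewrite mnmE.
exact: msupp_leM.
Qed.

Lemma msupp_le_linear i (c : R) : msupp_le U_(i) ('X_i - c%:MP).
Proof.
apply/allP => u /msuppB_le; rewrite mem_cat msuppX msuppC inE.
case/orP=> [/eqP->|]; first exact: lepm_refl.
case: ifP => // _; rewrite inE => /eqP->.
by apply/mnm_lepP => k; rewrite mnmE.
Qed.

Lemma msizeM_leq f g : (msize (f * g) <= (msize f + msize g).-1)%N.
Proof.
have [->|f0] := eqVneq f 0; first by rewrite mul0r msize0.
have [->|g0] := eqVneq g 0; first by rewrite mulr0 msize0.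
by rewrite msizeM.
Qed.

Lemma msize_mul_linear (I : Type) (s : seq I) f (k : I -> 'I_m) (c : I -> R) :
  (msize (f * \prod_(j <- s) ('X_(k j) - (c j)%:MP)) <= msize f + size s)%N.
Proof.
elim: s f => [|j s IH] f; first by rewrite big_nil mulr1 addn0.
rewrite big_cons mulrA; apply: leq_trans (IH _) _; rewrite /= addnS -addSn.
rewrite leq_add2r; apply: leq_trans (msizeM_leq _ _) _.
suff: (msize ('X_(k j) - (c j)%:MP : {mpoly R[m]}) <= 2)%N.
  by case: (msize _) => [|[|[|]]]; lia.
apply: leq_trans (msizeD_le _ _) _.
by rewrite mmeasureN msizeX msizeC mdeg1 geq_max /=; case: (_ == _).
Qed.

End Degrees.

(** * Vanishing sums over affine space *)

Section PowerSums.
Context (F : finFieldType) (m : nat).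

(** Translation by 1 permutes F, so it leaves the sum of all elements unchanged
    while adding #|F| * 1 to it. *)
Lemma card_finField_natr : #|F|%:R = 0 :> F.
Proof.
apply: (addrI (\sum_(x : F) x)); rewrite addr0 -sumr_const -big_split /=.
by rewrite [RHS](reindex_inj (addIr 1)).
Qed.

(** Scaling by a permutes F, so a^k S = S for the power sum S.  If S were nonzero,
    all q - 1 nonzero elements would be roots of X^k - 1. *)
Lemma sum_exp_finField k : (k < #|F|.-1)%N -> \sum_(x : F) x ^+ k = 0.
Proof.
case: k => [_|k lt_k].
  by under eq_bigr do rewrite expr0; rewrite sumr_const card_finField_natr.
apply/eqP/negPn/negP => S0.
have root1 (a : F) : a != 0 -> a ^+ k.+1 = 1.
  move=> a0; apply: (mulIf S0); rewrite mul1r mulr_sumr.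
  rewrite [RHS](reindex_inj (mulfI a0)) /=.
  by apply: eq_bigr => x _; rewrite exprMn.
have nz : 'X^(k.+1) - 1 != 0 :> {poly F} by rewrite -size_poly_gt0 size_XnsubC.
have := @max_poly_roots _ _ [seq x <- enum F | x != 0] nz.
rewrite size_XnsubC // filter_uniq ?enum_uniq //.
have -> : all (root ('X^(k.+1) - 1 : {poly F})) [seq x <- enum F | x != 0].
  apply/allP => a; rewrite mem_filter => /andP[/root1 a1 _].
  by rewrite rootE !hornerE a1 subrr.
move/(_ isT isT).
suff -> : size [seq x <- enum F | x != 0] = #|F|.-1 by lia.
rewrite -(cardC1 (0 : F)) cardE /enum_mem -filter_predI; congr size.
by apply: eq_filter => a; rewrite !inE andbT.
Qed.

(** The sum of a monomial over F^m is a product of power sums, and a degree below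
    m(q-1) forces some exponent below q-1. *)
Lemma sum_meval_eq0 (f : {mpoly F[m]}) :
  (msize f <= m * #|F|.-1)%N -> \sum_(x : 'rV[F]_m) f.@[x 0] = 0.
Proof.
move=> szf; under eq_bigr do rewrite mevalE.
rewrite exchange_big big_seq big1 //= => u uf; rewrite -mulr_sumr.
have [i lt_i] : exists i, (u i < #|F|.-1)%N.
  apply/existsP; apply: contraT; rewrite negb_exists => /forallP Hu.
  have := leq_trans (msize_mdeg_lt uf) szf; rewrite ltnNge mdegE.
  have -> : (m * #|F|.-1 = \sum_(i < m) #|F|.-1)%N.
    by rewrite sum_nat_const card_ord.
  by rewrite leq_sum // => i _; rewrite leqNgt Hu.
pose h (g : {ffun 'I_m -> F}) : 'rV[F]_m := \row_i g i.
rewrite (reindex h) /=; last first.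
  exists (fun x : 'rV_m => [ffun i => x 0 i]) => [g _|x _].
    by apply/ffunP => k; rewrite ffunE mxE.
  by apply/rowP => k; rewrite !mxE ffunE.
under eq_bigr do under eq_bigr do rewrite mxE.
rewrite -(bigA_distr_bigA (fun i x => x ^+ u i)) /=.
by rewrite (bigD1 i) //= sum_exp_finField // mul0r mulr0.
Qed.

End PowerSums.

(** * Polynomials supported on upper boxes *)

Section Points.
Context (F : finFieldType) (m : nat).
Implicit Types (x y z : 'rV[F]_m).
Local Notation Q := #|F|.-1.

Definition elt_index (a : F) : nat := index a (enum F).

Definition expo x : 'X_{1..m} := [multinom elt_index (x 0%R i) | i < m].

(** Its zeros in coordinate i are the elements numbered below x_i; it serves as a
    substitute for the monomial X^x whose support is explicit. *)
Definition box_poly x : {mpoly F[m]} :=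
  \prod_i \prod_(t < elt_index (x 0 i)) ('X_i - (nth 0 (enum F) t)%:MP).

Lemma leq_predcard k : (k <= Q)%N = (k < #|F|)%N.
Proof.
have F_gt0 : (0 < #|F|)%N by apply/card_gt0P; exists 0.
by rewrite -ltnS (prednK F_gt0).
Qed.

Lemma elt_index_lt a : (elt_index a < #|F|)%N.
Proof. by rewrite cardE index_mem mem_enum. Qed.

Lemma expo_le x i : (expo x i <= Q)%N.
Proof. by rewrite mnmE leq_predcard elt_index_lt. Qed.

Lemma mdeg_expo_le x : (mdeg (expo x) <= m * Q)%N.
Proof.
rewrite mdegE -[X in (_ <= X * _)%N]card_ord -sum_nat_const.
by rewrite leq_sum // => i _; apply: expo_le.
Qed.

Lemma expo_inj : injective expo.
Proof.
move=> x y /mnmP exy; apply/rowP => i; have := exy i.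
rewrite !mnmE => /(congr1 (nth 0 (enum F))).
by rewrite !nth_index ?mem_enum.
Qed.

Definition point (u : 'X_{1..m}) : 'rV[F]_m := \row_i nth 0 (enum F) (u i).

Lemma pointK (u : 'X_{1..m}) : (forall i, (u i <= Q)%N) -> expo (point u) = u.
Proof.
move=> ule; apply/mnmP => i.
by rewrite mnmE mxE /elt_index index_uniq ?enum_uniq // -cardE -leq_predcard.
Qed.

Lemma meval_box_poly x y :
  ((box_poly x).@[y 0] != 0) = (expo x <= expo y)%MM.
Proof.
rewrite rmorph_prod /= prodf_seq_neq0; apply/allP/mnm_lepP => H i.
  have := H i (mem_index_enum _); rewrite !mnmE /=.
  rewrite rmorph_prod /= prodf_seq_neq0 => /allP Hi.
  rewrite leqNgt; apply/negP => lt_yx.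
  have /= := Hi (Ordinal lt_yx) (mem_index_enum _).
  by rewrite mevalB mevalXU mevalC nth_index ?mem_enum // subrr eqxx.
move=> _ /=; rewrite rmorph_prod /= prodf_seq_neq0; apply/allP => t _ /=.
rewrite mevalB mevalXU mevalC subr_eq0; apply: contraTneq (H i) => yt.
rewrite !mnmE -ltnNge yt /elt_index index_uniq ?enum_uniq // -cardE.
exact: ltn_trans (ltn_ord t) (elt_index_lt _).
Qed.

Lemma msupp_box_poly x : msupp_le (expo x) (box_poly x).
Proof.
have -> : expo x = (\sum_i \sum_(t < elt_index (x 0%R i)) U_(i))%MM.
  apply/mnmP => k; rewrite mnm_sumE mnmE (bigD1 k) //=.
  rewrite [X in (_ + X)%N]big1 => [|i ik].
    rewrite mnm_sumE; under eq_bigr do rewrite mnm1E eqxx.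
    by rewrite sum_nat_const card_ord muln1 addn0.
  by rewrite mnm_sumE big1 // => t _; rewrite mnm1E (negbTE ik).
by apply: msupp_le_prod => i; apply: msupp_le_prod => t; apply: msupp_le_linear.
Qed.

Lemma box_poly_rm r x :
  (mdeg (expo x) <= r)%N -> box_poly x \in @rm_pred F r m.
Proof.
move=> lex; rewrite rm_predE; apply/allP => u.
move/(allP (msupp_box_poly x)) => /mnm_lepP ux; apply/andP; split.
  by apply: leq_trans lex; rewrite !mdegE leq_sum.
apply/forallP => i; apply: leq_ltn_trans (ux i) _.
by rewrite mnmE elt_index_lt.
Qed.

End Points.

(** * The dimension of a Reed-Muller code *)

Section Dimension.
Context (F : finFieldType) (m r : nat).
Context (P : 'I_(#|F| ^ m) -> 'rV[F]_m) (P_bij : bijective P).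

Definition eval_word (f : {mpoly F[m]}) : 'rV[F]_(#|F| ^ m) := \row_j f.@[P j 0].

Definition low_points : {set 'rV[F]_m} := [set x | (mdeg (expo x) <= r)%N].

Lemma weight_eval_word (f : {mpoly F[m]}) :
  weight (eval_word f) = #|[set x : 'rV[F]_m | f.@[x 0] != 0]|.
Proof.
rewrite -(on_card_preimset (f := P)); last exact: onW_bij.
by apply: eq_card => j; rewrite !inE mxE.
Qed.

Lemma eval_word_eq0 (f : {mpoly F[m]}) (x : 'rV[F]_m) : eval_word f = 0 -> f.@[x 0] = 0.
Proof.
move=> f0; have [P' _ PK] := P_bij; rewrite -(PK x).
by have /rowP/(_ (P' x)) := f0; rewrite !mxE.
Qed.

Lemma eval_word_RM f : f \in @rm_pred F r m -> eval_word f \in RM r P.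
Proof. by move=> fr; apply/RM_P; exists f. Qed.

(** In a dependency between the words of the [box_poly x], consider a term x of
    least degree: among the polynomials involved, only [box_poly x] is nonzero
    at x. *)
Lemma dim_RM_ge : (#|low_points| <= \dim (RM r P))%N.
Proof.
pose X := [tuple eval_word (box_poly (enum_val i)) | i < #|low_points|].
have/allP XC : all (mem (RM r P)) X.
  apply/allP => _ /mapP[i _ ->] /=; apply/eval_word_RM/box_poly_rm.
  by have := enum_valP i; rewrite inE.
suff/eqP dimX : free X.
  by rewrite -(size_tuple X) -dimX dimvS //; apply/span_subvP.
apply/freeP => k sum0 i; apply/eqP; apply: contraT => ki0.
have [j kj0 minj] :=
  @arg_minnP _ i (fun i => k i != 0) (fun i => mdeg (expo (enum_val i))) ki0.
have [P' _ PK] := P_bij; set x := enum_val j in minj.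
move/rowP/(_ (P' x)): sum0; rewrite summxE (bigD1 j) //= big1 => [|i' i'j].
  rewrite (nth_map j) ?size_enum_ord // nth_ord_enum !mxE PK addr0 => /eqP.
  by rewrite mulf_eq0 (negbTE kj0) -[_ == 0]negbK meval_box_poly lepm_refl.
rewrite (nth_map j) ?size_enum_ord // nth_ord_enum !mxE PK.
have [->|ki'] := eqVneq (k i') 0; first by rewrite mul0r.
apply/eqP; rewrite mulf_eq0 (negbTE ki') -[_ == 0]negbK meval_box_poly.
apply: contra i'j => le_x; apply/eqP/enum_val_inj/expo_inj.
exact: lem_mdeg_eq le_x (minj _ ki').
Qed.

(** The code is an image of the space of reduced polynomials of degree at most r,
    whose dimension is the number of its monomials. *)
Lemma dim_RM_le : (\dim (RM r P) <= #|low_points|)%N.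
Proof.
have := limg_ker_dim (linfun (@rm_eval F r m P)) fullv.
rewrite dimvf => Hdim.
apply: (@leq_trans #|[set u : 'X_{1..m < r.+1} | rm_mon F r u]|).
  by rewrite -[X in (_ <= X)%N]Hdim leq_addl.
have ptK (u : 'X_{1..m}) : rm_mon F r u -> expo (point F u) = u.
  by case/andP=> _ /forallP uq; apply: pointK => i; rewrite leq_predcard.
rewrite -(card_in_imset (f := fun u : 'X_{1..m < r.+1} => point F u)).
  apply/subset_leq_card/subsetP => _ /imsetP[u um ->].
  by move: um; rewrite !inE => um; rewrite ptK //; case/andP: um.
move=> u v; rewrite !inE => um vm /(congr1 (@expo F m)).
by rewrite !ptK // => /val_inj.
Qed.

Lemma dim_RM : \dim (RM r P) = #|low_points|.
Proof. by apply/eqP; rewrite eqn_leq dim_RM_le dim_RM_ge. Qed.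

End Dimension.

(** * Bounds on the minimum distance *)

Section Weights.
Context (F : finFieldType) (m r : nat).
Context (P : 'I_(#|F| ^ m) -> 'rV[F]_m) (P_bij : bijective P).
Local Notation Q := #|F|.-1.
Local Notation low_points := (low_points F m r).
Implicit Types (x y z : 'rV[F]_m).

Definition above x : {set 'rV[F]_m} := [set y | (expo x <= expo y)%MM].

Definition top_expo : 'X_{1..m} := [multinom Q | _ < m].

Lemma mdeg_top : mdeg top_expo = (m * Q)%N.
Proof.
by rewrite mdegE; under eq_bigr do rewrite mnmE; rewrite sum_nat_const card_ord.
Qed.

Lemma weight_box_word x :
  weight (eval_word P (box_poly x)) = #|above x|.
Proof.
by rewrite weight_eval_word //; apply: eq_card => y; rewrite !inE meval_box_poly.
Qed.

(** A point above x has larger degree unless it equals x. *)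
Lemma above_subset x : mdeg (expo x) = r -> above x \subset x |: ~: low_points.
Proof.
move=> dx; apply/subsetP => y; rewrite !inE => xy.
have [//=|nyx /=] := eqVneq y x.
apply: contra nyx => dy; apply/eqP/expo_inj/esym.
by apply: lem_mdeg_eq => //; rewrite dx.
Qed.

Lemma box_word_neq0 x : eval_word P (box_poly x) != 0.
Proof.
apply/eqP => /(eval_word_eq0 P_bij x)/eqP.
by rewrite -[_ == 0]negbK meval_box_poly lepm_refl.
Qed.

Lemma min_dist_le_box x : mdeg (expo x) = r ->
  (min_dist (RM r P) <= #|above x|)%N.
Proof.
move=> dx; rewrite -weight_box_word; apply: min_dist_le_weight (box_word_neq0 x).
by apply/eval_word_RM/box_poly_rm; rewrite dx.
Qed.

Lemma point_of_mdeg (a : 'X_{1..m}) : (a <= top_expo)%MM ->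
  (mdeg a <= r)%N -> (r <= m * Q)%N ->
  exists2 x : 'rV[F]_m, mdeg (expo x) = r & (a <= expo x)%MM.
Proof.
move=> atop da rN; have [|u /andP[au utop] du] := mdeg_between (d := r) atop.
  by rewrite da mdeg_top.
by exists (point F u); rewrite pointK // => i;
  have := mnm_lepP utop i; rewrite mnmE.
Qed.

Lemma min_dist_RM_le : (r <= m * Q)%N -> (min_dist (RM r P) <= #|~: low_points| + 1)%N.
Proof.
move=> rN; have [||x dx _] := point_of_mdeg (a := 0%MM) _ _ rN.
- by apply/mnm_lepP => i; rewrite mnm0E.
- by rewrite mdeg0.
apply: leq_trans (min_dist_le_box dx) _.
apply: leq_trans (subset_leq_card (above_subset dx)) _.
by rewrite cardsU1 addnC leq_add2l leq_b1.
Qed.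

(** The points x and z below satisfy deg x = r < deg z and z_0 < x_0.  Then z is a
    point of degree > r outside the support of [box_poly x], which lowers the
    bound of [min_dist_RM_le] by one. *)
Lemma min_dist_RM_lt_singleton : (1 < m)%N -> (0 < r)%N -> (r.+1 < m * Q)%N ->
  (min_dist (RM r P) <= #|~: low_points|)%N.
Proof.
move=> m_gt1 r_gt0 rN; pose i0 := Ordinal (ltnW m_gt1); pose c := minn r Q.
have Q_gt0 : (0 < Q)%N by case: (Q) rN => //; rewrite muln0.
have [||x dx ax] := @point_of_mdeg (U_(i0) *+ c)%MM _ _ (ltnW (ltnW rN)).
- apply/mnm_lepP => i; rewrite mulmnE mnm1E mnmE.
  by case: eqP => _; rewrite ?muln0 ?mul0n ?muln1 ?mul1n // geq_minr.
- by rewrite mdegMn mdeg1 mul1n geq_minl.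
(* All entries of u are q - 1 except u i0 = c - 1. *)
pose u := (top_expo - U_(i0) *+ (Q - c).+1)%MM.
have Uz : (U_(i0) *+ (Q - c).+1 <= top_expo)%MM.
  apply/mnm_lepP => i; rewrite mulmnE mnm1E mnmE.
  by case: eqP => _; rewrite ?muln0 ?mul0n ?muln1 ?mul1n // /c; lia.
have uQ i : (u i <= Q)%N by rewrite mnmBE mnmE; apply: leq_subr.
have u0 : (u i0 < c)%N.
  by rewrite mnmBE mnmE mulmnE mnm1E eqxx /c; lia.
have du : (r < mdeg u)%N.
  have := congr1 (fun v : 'X_{1..m} => mdeg v) (submK Uz).
  rewrite mdegD mdegMn mdeg1 mul1n mdeg_top -/u => dE.
  (* If r > q - 1 then c = q - 1 and deg u = N - 1.  Otherwise c = r and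
     deg u = N - q + r, which exceeds r because N > r + 1 and N >= 2(q - 1). *)
  have [rQ|rQ] := leqP r Q; last first.
    by move: dE; rewrite /c (minn_idPr (ltnW rQ)); lia.
  have : (2 * Q <= m * Q)%N by rewrite leq_mul2r m_gt1 orbT.
  move: dE; rewrite /c (minn_idPl rQ).
  nia.
set z := point F u; have zu : expo z = u by apply: pointK.
have zhigh : z \in ~: low_points by rewrite !inE zu -ltnNge.
have nxz : z \notin above x.
  rewrite inE zu; apply/negP => /mnm_lepP/(_ i0).
  have := mnm_lepP ax i0; rewrite mulmnE mnm1E eqxx mul1n.
  by move: u0; lia.
apply: leq_trans (min_dist_le_box dx) _.
have sub : above x \subset x |: (~: low_points :\ z).
  apply/subsetP => y xy; have := subsetP (above_subset dx) y xy.
  rewrite in_setU1 in_setU1 in_setD1.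
  have [yz|//] := eqVneq y z; by rewrite -yz xy in nxz.
apply: leq_trans (subset_leq_card sub) _.
by rewrite cardsU1 [X in (_ <= X)%N](cardsD1 z) zhigh leq_add2r leq_b1.
Qed.

(** After multiplication by linear forms that kill all but one point of the
    support, the sum of the values is nonzero, so the degree is at least
    m(q-1); each form raised it by at most one. *)
Lemma weight_gt_of_degree (f : {mpoly F[m]}) : (0 < m)%N -> (msize f <= r.+1)%N ->
  eval_word P f != 0 -> (m * Q < weight (eval_word P f) + r)%N.
Proof.
move=> m_gt0 szf f0; rewrite weight_eval_word // ltnNge; apply/negP.
set S := [set x | _] => leN.
have [x0 fx0] : exists x0 : 'rV[F]_m, f.@[x0 0] != 0.
  have [j] : exists j, eval_word P f 0 j != 0 by apply/rV0Pn.
  by rewrite mxE; exists (P j).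
have [k kP] : exists k : 'rV[F]_m -> 'I_m,
    forall y, y != x0 -> y 0 (k y) != x0 0 (k y).
  apply: (@fin_all_exists _ (fun=> 'I_m)
     (fun y i => y != x0 -> y 0 i != x0 0 i)) => y.
  have [_|] := eqVneq y x0; first by exists (Ordinal m_gt0).
  rewrite -subr_eq0 => /rV0Pn[i]; rewrite !mxE subr_eq0.
  by exists i.
pose sep : {mpoly F[m]} :=
  \prod_(y <- enum (S :\ x0)) ('X_(k y) - (y 0 (k y))%:MP).
have sepE (x : 'rV[F]_m) :
    sep.@[x 0] = \prod_(y <- enum (S :\ x0)) (x 0 (k y) - y 0 (k y)).
  rewrite rmorph_prod; apply: eq_bigr => y _.
  by rewrite /= mevalB mevalXU mevalC.
have x0S : x0 \in S by rewrite inE.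
have : \sum_(x : 'rV[F]_m) (f * sep).@[x 0] = 0.
  apply: sum_meval_eq0; apply: leq_trans (msize_mul_linear _ _ _ _) _.
  rewrite -cardE; apply: leq_trans leN.
  by rewrite [#|S|](cardsD1 x0) x0S addnAC leq_add2r add1n.
rewrite (bigD1 x0) //= big1 ?addr0 => [/eqP|x xx0].
  rewrite mevalM mulf_eq0 (negbTE fx0) sepE prodf_seq_eq0 => /hasP[y].
  rewrite mem_enum !inE => /andP[yx0 _]; rewrite subr_eq0 eq_sym.
  by rewrite (negbTE (kP _ yx0)).
rewrite mevalM; have [xS|] := boolP (x \in S); last first.
  by rewrite inE negbK => /eqP->; rewrite mul0r.
apply/eqP; rewrite mulf_eq0 sepE prodf_seq_eq0; apply/orP; right.
by apply/hasP; exists x; rewrite ?mem_enum ?in_setD1 ?xx0 //= subrr.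
Qed.

Lemma card_high_points_le :
    {in ~: low_points &, injective (fun x : 'rV[F]_m => mdeg (expo x))} ->
  (#|~: low_points| <= m * Q - r)%N.
Proof.
move=> inj; rewrite cardE -(size_map (fun x : 'rV[F]_m => mdeg (expo x))).
rewrite -(size_iota r.+1 (m * Q - r)); apply: uniq_leq_size.
  rewrite map_inj_in_uniq ?enum_uniq // => x y.
  by rewrite !mem_enum; apply: inj.
move=> _ /mapP[x + ->]; rewrite mem_enum mem_iota !inE -ltnNge => lt_rx.
by have := mdeg_expo_le x; lia.
Qed.

End Weights.

(** * Characterization of the MDS codes *)

Theorem corollary11 (F : finFieldType) (m r : nat)
    (P : 'I_(#|F| ^ m) -> 'rV[F]_m) (P_bij : bijective P)
    (m_ge1 : (1 <= m)%N) (r_le : (r <= m * (#|F| - 1))%N) :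
  MDS (RM r P) <->
  (m = 1%N \/ r = 0%N \/ (m * (#|F| - 1) - 1 <= r)%N).
Proof.
rewrite subn1 in r_le *; set Q := #|F|.-1 in r_le *.
have nE : (#|F| ^ m = #|low_points F m r| + #|~: low_points F m r|)%N.
  by rewrite cardsC card_mx mul1n.
have codim : (#|F| ^ m - \dim (RM r P))%N = #|~: low_points F m r|.
  by rewrite (dim_RM r P_bij) nE addKn.
rewrite /MDS codim; split=> [[_ dE]|cases].
  have [->|m_neq1] := eqVneq m 1%N; first by left.
  have [->|r_neq0] := eqVneq r 0%N; first by right; left.
  right; right; rewrite leqNgt; apply/negP => r_lt.
  suff : (min_dist (RM r P) <= #|~: low_points F m r|)%N by rewrite dE; lia.
  by apply: min_dist_RM_lt_singleton => //; rewrite -/Q; lia.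
have low_gt0 : (0 < #|low_points F m r|)%N.
  apply/card_gt0P; exists (point F 0%MM).
  by rewrite inE pointK ?mdeg0 // => i; rewrite mnm0E.
split; first by rewrite (dim_RM r P_bij).
apply/eqP; rewrite eqn_leq min_dist_RM_le //=.
have len : (#|~: low_points F m r| + 1 <= #|F| ^ m)%N.
  by rewrite nE addnC leq_add2r.
apply: le_min_dist => // c /RM_P[f /andP[szf _] ->] fc0.
have [r0|r_neq0] := eqVneq r 0%N.
  have [c0 fE] : exists c0, f = c0%:MP.
    by exists f@_0; apply: msize1_polyC; rewrite -r0.
  have /rV0Pn[j] := fc0; rewrite mxE fE mevalC => c0_neq0.
  apply: leq_trans len _; rewrite -[X in (X <= _)%N]card_ord.
  rewrite subset_leq_card //; apply/subsetP => i _.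
  by rewrite inE mxE mevalC.
have {cases} inj :
    {in ~: low_points F m r &, injective (fun x : 'rV[F]_m => mdeg (expo x))}.
  case: cases => [m1 x y _ _|[/eqP|r_high x y]]; last 2 first.
  - by rewrite (negbTE r_neq0).
  - have topE z : z \in ~: low_points F m r -> expo z = top_expo F m.
      rewrite !inE -ltnNge => z_high; apply: lem_mdeg_eq.
        by apply/mnm_lepP => i; rewrite [top_expo F m i]mnmE expo_le.
      by rewrite mdeg_top -/Q; lia.
    by move=> /topE ex /topE ey _; apply: expo_inj; rewrite ex ey.
  have oneE (i k : 'I_m) : k = i.
    by apply/val_inj; have := ltn_ord i; have := ltn_ord k; rewrite /=; lia.
  have mdeg1E (i : 'I_m) (u : 'X_{1..m}) : mdeg u = u i.
    by rewrite mdegE (bigD1 i) //= big1 ?addn0 // => k; rewrite (oneE i k) eqxx.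
  by move=> exy; apply/expo_inj/mnmP => i; rewrite -!mdeg1E.
rewrite addn1; apply: leq_ltn_trans (card_high_points_le inj) _.
rewrite -(ltn_add2r r) subnK //; exact: weight_gt_of_degree.
Qed.
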